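(* Let $\Theta=[a,b]$ be a finite interval partitioned into $\Lambda_1,\dots,\Lambda_N$ with points $\bar h_i\in\Lambda_i$, let $\gamma>0$, and let $\sigma_{A,i},\sigma_{B,i},\sigma_{C,i},\sigma_{Q,i}>0$ be scalars such that, for $\mu$-almost all $\ell\in\Lambda_i$ and all $i=1,\dots,N$, $$\|A(\ell)-A_i\|\le\sigma_{A,i},\quad \|B(\ell)-B_i\|\le\sigma_{B,i},\quad \|C(\ell)-C_i\|\le\sigma_{C,i},\quad \|Q(\ell)-Q_i\|\le\sigma_{Q,i}.$$ If the LMI-Problem (defined in the context) with these scalars and this $\gamma$ is feasible, then the uncertain system $x(k+1)=[A(\vartheta(k))+B(\vartheta(k))\Delta(\vartheta(k))C(\vartheta(k))]x(k)$, $k\in\mathbb{N}$, is robustly stable, i.e. it is exponentially mean-square stable for every $\Delta\in\mathcal{H}^{r\times r}_\infty$ with $\|\Delta\|_{\mathcal{H}^{r\times r}_\infty}\le(\sqrt\gamma)^{-1}$.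
   Context: $\Theta=[a,b]$, $a<b$ real, with Borel $\sigma$-algebra and a $\sigma$-finite measure $\mu$. Matrices carry the spectral norm. $\mathcal{H}^{n\times m}_{\infty}$: measurable $P:\Theta\to\mathbb{R}^{n\times m}$ with $\|P\|_{\mathcal{H}^{n\times m}_\infty}=\operatorname{ess\,sup}_\ell\|P(\ell)\|<\infty$. $A\in\mathcal{H}^{n\times n}_\infty$, $B\in\mathcal{H}^{n\times r}_\infty$, $C\in\mathcal{H}^{r\times n}_\infty$. $\{\vartheta(k)\}_{k\in\mathbb{N}}$ is a Markov chain in $\Theta$ with initial density $\nu_0$ with respect to $\mu$, $\nu_0>0$ $\mu$-a.e., and transition kernel $\mathbb{G}(\ell,\Lambda)=\int_\Lambda g(\ell,t)\mu(dt)$, with $\int_\Theta g(t,\ell)\mu(dt)>0$ $\mu$-a.e. (standing assumptions). An autonomous system is exponentially mean-square stable if there are $\beta>0$, $\alpha\in(0,1)$ such that for any initial conditions $(x_0,\vartheta_0)$, with $x_0\in\mathbb{R}^n$ deterministic and $\vartheta_0=\vartheta(0)$, $\mathbf{E}\{\|x(k)\|^2\}\le\beta\alpha^k\|x_0\|^2$ for all $k\in\mathbb{N}$. Grid: $a=h_0<h_1<\dots<h_N=b$; $\Lambda_i=[h_{i-1},h_i)$ for $i\le N-1$, $\Lambda_N=[h_{N-1},h_N]$; $\bar h_i\in\Lambda_i$. $q_i(\ell)=\int_{\Lambda_i}g(\ell,t)\mu(dt)$; $Q(\ell)=[\sqrt{q_1(\ell)}I_n\ \cdots\ \sqrt{q_N(\ell)}I_n]\in\mathbb{R}^{n\times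 nN}$; $A_i=A(\bar h_i)$, $B_i=B(\bar h_i)$, $C_i=C(\bar h_i)$, $Q_i=Q(\bar h_i)$. LMI-Problem: given $\gamma>0$ and positive scalars $\sigma_{A,i},\sigma_{B,i},\sigma_{C,i},\sigma_{Q,i}$, find, for $i=1,\dots,N$, nonsingular $X_i\in\mathbb{R}^{n\times n}$, symmetric positive definite $P_i\in\mathbb{R}^{n\times n}$, and scalars $\alpha_i,\beta_i,\rho_i>0$ such that $\Pi^1_i>0$ for all $i=1,\dots,N$. Here $\Upsilon=\mathrm{diag}\{P_1,\dots,P_N\}$ and $\Pi^1_i$ is the symmetric $14\times14$ block matrix with block sizes $(n,r,n,r,nN,r,n,n,n,r,r,nN,n,r)$, with diagonal blocks, in order, $X_i+X_i^T,\ I,\ P_i,\ \gamma I,\ \Upsilon,\ 2\alpha_iI,\ 2\alpha_iI,\ \alpha_iI,\ \beta_iI,\ \beta_iI,\ \beta_iI,\ \rho_iI,\ \rho_iI,\ \rho_iI$, with the following blocks above the diagonal (position: value): $(1,3)$: $X_iA_i$; $(1,4)$: $X_iB_i$; $(1,5)$: $Q_i\Upsilon$; $(1,7)$: $2\sigma_{A,i}X_i$; $(1,9)$: $\sigma_{B,i}X_i$; $(1,13)$: $\rho_iI$; $(2,3)$: $C_i$; $(2,6)$: $2\sigma_{C,i}I$; $(2,14)$: $\rho_iI$; $(3,8)$: $\alpha_iI$; $(4,11)$: $\beta_iI$; $(5,12)$: $\sigma_{Q,i}\Upsilon$; all other blocks above the diagonal zero, and blocks below the diagonal given by symmetry. 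*)

(* Defs.v *)
From HB Require Import structures.
From mathcomp Require Import all_boot all_order all_algebra.
From mathcomp Require Import all_classical all_reals all_analysis.
From mathcomp Require Import ess_sup_inf.

Set Implicit Arguments.
Unset Strict Implicit.
Unset Printing Implicit Defensive.

Import Order.TTheory GRing.Theory Num.Theory.
Import numFieldNormedType.Exports.

Local Open Scope classical_set_scope.
Local Open Scope ring_scope.

(* The compact interval [a, b] as a type, carrying the trace of the Borel
   sigma-algebra of R.  The proof of a < b is a parameter because
   measurable types are required to be inhabited. *)
Definition segment (R : realType) (a b : R) (ab : a < b) : Type :=
  {x : R | x \in `[a, b]}.

HB.instance Definition _ (R : realType) (a b : R) (ab : a < b) :=
  Choice.on (segment ab).

Lemma left_in_segment (R : realType) (a b : R) (ab : a < b) : a \in `[a, b].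
Proof. by rewrite in_itv /= lexx ltW. Qed.

HB.instance Definition _ (R : realType) (a b : R) (ab : a < b) :=
  isPointed.Build (segment ab)
    (exist (fun x : R => x \in `[a, b]) a (left_in_segment ab)).

Definition segment_val (R : realType) (a b : R) (ab : a < b) (l : segment ab) :
  measurableTypeR R := val l.

Notation Theta ab := (g_sigma_algebra_preimageType (@segment_val _ _ _ ab)).

Section Norms.
Context {R : realType}.

Definition enorm (n : nat) (x : 'cV[R]_n) : R :=
  Num.sqrt (\sum_i x i ord0 ^+ 2).

Definition specnorm (n m : nat) (M : 'M[R]_(n, m)) : R :=
  sup [set enorm (M *m x) | x in [set x : 'cV[R]_m | enorm x <= 1]].

Definition posdef (n : nat) (M : 'M[R]_n) : Prop :=
  M^T = M /\ forall x : 'cV[R]_n, x != 0 -> 0 < (x^T *m M *m x) ord0 ord0.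

End Norms.

Section Hinf.
Context {R : realType} {d : measure_display} {T : measurableType d}.
Variable mu : {measure set T -> \bar R}.

(* Measurability is with respect to the Borel sigma-algebra of the space of
   matrices. *)
Definition mx_measurable (n m : nat) (P : T -> 'M[R]_(n, m)) : Prop :=
  measurable_fun setT
    (P : T -> g_sigma_algebraType (@open 'M[R]_(n, m))).

Definition Hnorm (n m : nat) (P : T -> 'M[R]_(n, m)) : \bar R :=
  ess_sup mu (fun l => (specnorm (P l))%:E).

Definition Hinf (n m : nat) (P : T -> 'M[R]_(n, m)) : Prop :=
  mx_measurable P /\ (Hnorm P < +oo)%E.

End Hinf.

Section MarkovChain.
Context {R : realType} {d : measure_display} {T : measurableType d}.
Variable mu : {measure set T -> \bar R}.

Definition kernel_density (G : R.-pker T ~> T) (g : T -> T -> R) : Prop :=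
  [/\ measurable_fun [set: T * T] (fun p => g p.1 p.2),
      forall l t, 0 <= g l t &
      forall l L, measurable L -> G l L = (\int[mu]_(t in L) (g l t)%:E)%E].

Definition initial_density (nu0 : T -> R) : Prop :=
  [/\ measurable_fun setT nu0, forall l, 0 <= nu0 l &
      {ae mu, forall l, 0 < nu0 l}].

(* The sigma-algebra generated by theta 0, ..., theta k. *)
Definition history d' (Omega : measurableType d')
    (theta : nat -> Omega -> T) (k : nat) : set (set Omega) :=
  <<s [set E | exists2 j, (j <= k)%N &
        exists2 U, measurable U & E = theta j @^-1` U] >>.

(* The last clause says that G (theta k) L is a version of the conditional
   probability of theta k.+1 \in L given theta 0, ..., theta k. *)
Definition markov_chain (G : R.-pker T ~> T) (nu0 : T -> R)
    d' (Omega : measurableType d') (P : probability Omega R)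
    (theta : nat -> Omega -> T) : Prop :=
  [/\ forall k, measurable_fun setT (theta k),
      forall L, measurable L ->
        P (theta 0%N @^-1` L) = (\int[mu]_(t in L) (nu0 t)%:E)%E &
      forall k L E, measurable L -> history theta k E ->
        P (E `&` theta k.+1 @^-1` L) = (\int[P]_(w in E) G (theta k w) L)%E].

Fixpoint trajectory (n : nat) (F : T -> 'M[R]_n) (Omega : Type)
    (theta : nat -> Omega -> T) (x0 : 'cV[R]_n) (k : nat) (w : Omega) :
    'cV[R]_n :=
  if k is k'.+1 then F (theta k' w) *m trajectory F theta x0 k' w else x0.

(* An initial condition is a deterministic x0 together with a random theta 0:
   the constants beta and alpha are uniform in x0 and in all realisations of
   the chain with an a.e. positive initial density. *)
Definition ems_stable (G : R.-pker T ~> T) (n : nat) (F : T -> 'M[R]_n) :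
    Prop :=
  exists beta alpha : R, [/\ 0 < beta, 0 < alpha < 1 &
    forall (d' : measure_display) (Omega : measurableType d')
      (P : probability Omega R) (nu0 : T -> R) (theta : nat -> Omega -> T),
      initial_density nu0 -> markov_chain G nu0 P theta ->
      forall (x0 : 'cV[R]_n) (k : nat),
        ('E_P[fun w => (enorm (trajectory F theta x0 k w) ^+ 2)%R] <=
          (beta * alpha ^+ k * enorm x0 ^+ 2)%:E)%E].

Definition robustly_stable (G : R.-pker T ~> T) (n r : nat)
    (A : T -> 'M[R]_n) (B : T -> 'M[R]_(n, r)) (C : T -> 'M[R]_(r, n))
    (gamma : R) : Prop :=
  forall Delta : T -> 'M[R]_r, Hinf mu Delta ->
    (Hnorm mu Delta <= ((Num.sqrt gamma)^-1)%:E)%E ->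
    ems_stable G (fun l => A l + B l *m Delta l *m C l).

End MarkovChain.

Section Grid.
Context {R : realType}.

Definition grid (a b : R) (N : nat) (h : nat -> R) : Prop :=
  [/\ h 0%N = a, h N = b & forall i, (i < N)%N -> h i < h i.+1].

(* Cells are numbered from 0; only the last one is closed on the right. *)
Definition cell (a b : R) (ab : a < b) (N : nat) (h : nat -> R) (i : 'I_N) :
    set (Theta ab) :=
  [set l | if i.+1 == N then h i <= segment_val l <= h i.+1
           else h i <= segment_val l < h i.+1].

Context {d : measure_display} {T : measurableType d}.
Variable mu : {measure set T -> \bar R}.

Definition cell_prob (g : T -> T -> R) (N : nat) (Lambda : 'I_N -> set T)
    (i : 'I_N) (l : T) : R :=
  \int[mu]_(t in Lambda i) g l t.

Definition Qmx (n : nat) (g : T -> T -> R) (N : nat)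
    (Lambda : 'I_N -> set T) (l : T) : 'M[R]_(n, \sum_(j < N) n) :=
  \mxrow_(j < N) (Num.sqrt (cell_prob g Lambda j l))%:M.

End Grid.

Arguments cell {R a b ab} N h i.

Section LMI.
Context {R : realType}.

Definition symblock (m p : nat) (D : 'M[R]_m) (O : 'M[R]_(m, p))
    (S : 'M[R]_p) : 'M[R]_(m + p) := block_mx D O O^T S.

Notation "[ 'row' x , .. , y & z ]" := (row_mx x .. (row_mx y z) ..)
  (at level 0, format "[ 'row'  x ,  .. ,  y  &  z ]").

(* Each line gives a diagonal block and the blocks to its right. *)
Definition Pi1 (n r s : nat) (A : 'M[R]_n) (B : 'M[R]_(n, r))
    (C : 'M[R]_(r, n)) (Q : 'M[R]_(n, s)) (gamma sA sB sC sQ : R)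
    (X P : 'M[R]_n) (U : 'M[R]_s) (alpha beta rho : R) :=
  symblock (X + X^T) [row 0, X *m A, X *m B, Q *m U, 0, (2 * sA) *: X, 0,
                          sB *: X, 0, 0, 0, rho%:M & 0] (
  symblock (1%:M : 'M[R]_r) [row C, 0, 0, (2 * sC)%:M, 0, 0, 0, 0, 0, 0, 0
                              & rho%:M] (
  symblock P [row 0, 0, 0, 0, alpha%:M, 0, 0, 0, 0, 0 & 0] (
  symblock (gamma%:M : 'M[R]_r) [row 0, 0, 0, 0, 0, 0, beta%:M, 0, 0 & 0] (
  symblock U [row 0, 0, 0, 0, 0, 0, sQ *: U, 0 & 0] (
  symblock ((2 * alpha)%:M : 'M[R]_r) 0 (
  symblock ((2 * alpha)%:M : 'M[R]_n) 0 (
  symblock (alpha%:M : 'M[R]_n) 0 (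
  symblock (beta%:M : 'M[R]_n) 0 (
  symblock (beta%:M : 'M[R]_r) 0 (
  symblock (beta%:M : 'M[R]_r) 0 (
  symblock (rho%:M : 'M[R]_s) 0 (
  symblock (rho%:M : 'M[R]_n) 0
           (rho%:M : 'M[R]_r))))))))))))).

Definition LMI_feasible (n r N : nat)
    (A : 'I_N -> 'M[R]_n) (B : 'I_N -> 'M[R]_(n, r)) (C : 'I_N -> 'M[R]_(r, n))
    (Q : 'I_N -> 'M[R]_(n, \sum_(j < N) n))
    (gamma : R) (sA sB sC sQ : 'I_N -> R) : Prop :=
  exists (X P : 'I_N -> 'M[R]_n) (alpha beta rho : 'I_N -> R),
    forall i : 'I_N,
      [/\ X i \in unitmx, posdef (P i),
          [/\ 0 < alpha i, 0 < beta i & 0 < rho i] &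
          posdef (Pi1 (A i) (B i) (C i) (Q i) gamma (sA i) (sB i) (sC i) (sQ i)
            (X i) (P i) (\mxdiag_(j < N) P j) (alpha i) (beta i) (rho i))].

End LMI.

(* Main.v *)
(** The Lyapunov function is [V(l, x) = sum_j 1_(Lambda_j)(l) x^T P_j x].
    Evaluating the quadratic form of [Pi1] at one well chosen vector gives, for
    almost every [l] in [Lambda_i], with [y = (A + B Delta C)(l) x],
    [y^T (sum_j q_j(l) P_j) y + e_i |x|^2 <= x^T P_i x] for some [e_i > 0].
    By the Markov property the expectation of [V(theta(k+1), x(k+1))] given the
    past is the first term at [l = theta(k)], [x = x(k)], so the expectation of
    [V] decays geometrically.  Since [nu0 dmu] and the transition kernel have
    densities, every [theta(k)] avoids the [mu]-null exceptional set. *)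
Require Import Defs.
From mathcomp Require Import all_boot all_order all_algebra.
From mathcomp Require Import all_classical all_reals all_analysis.
From mathcomp Require Import measurable_realfun ess_sup_inf ring lra.

Set Implicit Arguments.
Unset Strict Implicit.
Unset Printing Implicit Defensive.

Import Order.TTheory GRing.Theory Num.Theory.
Import numFieldNormedType.Exports.

Local Open Scope classical_set_scope.
Local Open Scope ring_scope.

(** * Quadratic forms, the Euclidean norm and the spectral norm *)

Section Dot.
Context {R : realType}.
Implicit Types (n m : nat).

Definition dot n (u v : 'cV[R]_n) : R := (u^T *m v) ord0 ord0.

Lemma dotE n (u v : 'cV[R]_n) : dot u v = \sum_i u i ord0 * v i ord0.
Proof. by rewrite /dot mxE; apply: eq_bigr => i _; rewrite mxE. Qed.

Lemma dotC n (u v : 'cV[R]_n) : dot u v = dot v u.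
Proof. by rewrite !dotE; apply: eq_bigr => i _; rewrite mulrC. Qed.

Lemma dotDr n (u v w : 'cV[R]_n) : dot u (v + w) = dot u v + dot u w.
Proof. by rewrite /dot mulmxDr mxE. Qed.

Lemma dotDl n (u v w : 'cV[R]_n) : dot (v + w) u = dot v u + dot w u.
Proof. by rewrite dotC dotDr !(dotC u). Qed.

Lemma dotZr n a (u v : 'cV[R]_n) : dot u (a *: v) = a * dot u v.
Proof. by rewrite /dot -scalemxAr mxE. Qed.

Lemma dotZl n a (u v : 'cV[R]_n) : dot (a *: u) v = a * dot u v.
Proof. by rewrite dotC dotZr dotC. Qed.

Lemma dotNr n (u v : 'cV[R]_n) : dot u (- v) = - dot u v.
Proof. by rewrite /dot mulmxN mxE. Qed.

Lemma dotNl n (u v : 'cV[R]_n) : dot (- u) v = - dot u v.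
Proof. by rewrite dotC dotNr dotC. Qed.

Lemma dot0r n (u : 'cV[R]_n) : dot u 0 = 0.
Proof. by rewrite /dot mulmx0 mxE. Qed.

Lemma dot0l n (u : 'cV[R]_n) : dot 0 u = 0.
Proof. by rewrite dotC dot0r. Qed.

Lemma dot_mulmxr m n (u : 'cV[R]_m) (M : 'M[R]_(m, n)) (v : 'cV[R]_n) :
  dot u (M *m v) = dot (M^T *m u) v.
Proof. by rewrite /dot trmx_mul trmxK mulmxA. Qed.

Lemma dot_col_mx m n (u1 v1 : 'cV[R]_m) (u2 v2 : 'cV[R]_n) :
  dot (col_mx u1 u2) (col_mx v1 v2) = dot u1 v1 + dot u2 v2.
Proof. by rewrite /dot tr_col_mx mul_row_col mxE. Qed.

Lemma dot_ge0 n (u : 'cV[R]_n) : 0 <= dot u u.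
Proof. by rewrite dotE; apply: sumr_ge0 => i _; rewrite -expr2 sqr_ge0. Qed.

Lemma dot_eq0 n (u : 'cV[R]_n) : (dot u u == 0) = (u == 0).
Proof.
apply/idP/eqP => [|->]; last by rewrite dot0r.
rewrite dotE psumr_eq0; last by move=> i _; rewrite -expr2 sqr_ge0.
move/allP => u0; apply/matrixP => i j; rewrite ord1 mxE.
by have /implyP/(_ isT) := u0 i (mem_index_enum _); rewrite mulf_eq0 orbb => /eqP.
Qed.

Lemma enorm_sqr n (u : 'cV[R]_n) : enorm u ^+ 2 = dot u u.
Proof.
rewrite /enorm sqr_sqrtr ?dotE//.
by apply: sumr_ge0 => i _; rewrite sqr_ge0.
Qed.

Lemma enorm_ge0 n (u : 'cV[R]_n) : 0 <= enorm u.
Proof. exact: sqrtr_ge0. Qed.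

Lemma enormZ n a (u : 'cV[R]_n) : 0 <= a -> enorm (a *: u) = a * enorm u.
Proof.
move=> a0; apply/eqP; rewrite -(@eqrXn2 _ 2)// ?mulr_ge0 ?enorm_ge0//.
by rewrite exprMn !enorm_sqr dotZl dotZr mulrA -expr2.
Qed.

(** A crude but explicit substitute for the operator norm, used wherever only some finite constant
    is needed. *)
Definition mxsum1 n m (M : 'M[R]_(n, m)) : R := \sum_i \sum_j `|M i j|.

Lemma mxsum1_ge0 n m (M : 'M[R]_(n, m)) : 0 <= mxsum1 M.
Proof. by apply: sumr_ge0 => i _; apply: sumr_ge0. Qed.

Lemma dot_mulmx_le n (M : 'M[R]_n) (u : 'cV[R]_n) :
  dot u (M *m u) <= mxsum1 M * dot u u.
Proof.
have le1 i : u i ord0 ^+ 2 <= dot u u.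
  rewrite dotE (bigD1 i)//= -expr2 lerDl.
  by apply: sumr_ge0 => j _; rewrite -expr2 sqr_ge0.
rewrite dotE mulr_suml; apply: ler_sum => i _.
rewrite mxE mulr_sumr mulr_suml; apply: ler_sum => j _.
apply: (le_trans (ler_norm _)); rewrite mulrCA normrM ler_wpM2l//.
have := le1 i; have := le1 j; rewrite ler_norml => ? ?.
have := sqr_ge0 (u i ord0 - u j ord0); have := sqr_ge0 (u i ord0 + u j ord0).
by move=> ? ?; nra.
Qed.

(** Expand the square of [t *: u - v] and divide by [t]. *)
Lemma dot_young n t (u v : 'cV[R]_n) : 0 < t ->
  2 * dot u v <= t * dot u u + t^-1 * dot v v.
Proof.
move=> t0; have := dot_ge0 (t *: u - v).
rewrite dotDl !dotDr !dotNl !dotNr !dotZl !dotZr (dotC v u) => h.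
rewrite -(@ler_pM2l _ t)// mulrDr [t * (t^-1 * _)]mulrA divff ?gt_eqF// mul1r.
lra.
Qed.

Lemma specnormP n m (M : 'M[R]_(n, m)) (u : 'cV[R]_m) :
  enorm (M *m u) <= specnorm M * enorm u.
Proof.
pose S := [set enorm (M *m x) | x in [set x : 'cV[R]_m | enorm x <= 1]].
have Sub : has_ubound S.
  (* The [sup] of an unbounded set is a default value, so boundedness comes first. A bound K on the
     squared norm gives the bound K + 1 on the norm. *)
  exists (mxsum1 (M^T *m M) + 1) => _ [x x1 <-].
  have K0 := mxsum1_ge0 (M^T *m M).
  have : enorm (M *m x) ^+ 2 <= mxsum1 (M^T *m M).
    rewrite enorm_sqr dot_mulmxr dotC mulmxA (le_trans (dot_mulmx_le _ _))//.
    by rewrite ler_piMr// -enorm_sqr expr_le1// enorm_ge0.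
  by have := enorm_ge0 (M *m x); nra.
have [/eqP|u0] := boolP (enorm u == 0).
  move=> e0; have : dot u u == 0 by rewrite -enorm_sqr e0 expr2 mul0r.
  by rewrite dot_eq0 => /eqP ->; rewrite -(scale0r 0) -scalemxAr !enormZ// !mul0r mulr0.
have {}u0 : 0 < enorm u by rewrite lt_neqAle eq_sym u0 enorm_ge0.
rewrite -ler_pdivrMr// mulrC -enormZ ?invr_ge0 ?enorm_ge0// scalemxAr.
apply: ub_le_sup => //; eexists => //=.
by rewrite enormZ ?invr_ge0 ?enorm_ge0// mulVf ?gt_eqF.
Qed.

Lemma specnorm_dot n m (M : 'M[R]_(n, m)) (s : R) (u : 'cV[R]_m) :
  0 <= s -> specnorm M <= s -> dot (M *m u) (M *m u) <= s ^+ 2 * dot u u.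
Proof.
move=> s0 Ms; rewrite -!enorm_sqr -exprMn lerXn2r ?nnegrE ?mulr_ge0 ?enorm_ge0//.
by rewrite (le_trans (specnormP _ _))// ler_wpM2r// enorm_ge0.
Qed.

Lemma posdef_dot n (M : 'M[R]_n) (u : 'cV[R]_n) :
  posdef M -> u != 0 -> 0 < dot u (M *m u).
Proof. by move=> [_ /(_ u)] + u0; rewrite /dot mulmxA; apply. Qed.

Lemma posdef_dot_ge0 n (M : 'M[R]_n) (u : 'cV[R]_n) :
  posdef M -> 0 <= dot u (M *m u).
Proof.
by move=> pM; have [->|/(posdef_dot pM)/ltW//] := eqVneq u 0; rewrite dot0l.
Qed.

Lemma posdef_unit n (M : 'M[R]_n) : posdef M -> M \in unitmx.
Proof.
move=> pM; rewrite unitmxE unitfE; apply/det0P => -[v v0 vM].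
have : v^T != 0 by rewrite -(inj_eq (@trmx_inj _ _ _)) trmxK trmx0.
by move=> /(posdef_dot pM); rewrite /dot trmxK mulmxA vM mul0mx mxE ltxx.
Qed.

(* Expand the form at [u - k^-1 *: (M^-1 *m u)], where [k] bounds [M^-1]. *)
Lemma posdef_coercive n (M : 'M[R]_n) : posdef M ->
  exists2 e : R, 0 < e & forall u, e * dot u u <= dot u (M *m u).
Proof.
move=> pM; have uM := posdef_unit pM.
pose k := mxsum1 (invmx M) + 1.
have k0 : 0 < k by rewrite ltr_wpDl ?mxsum1_ge0.
exists k^-1; first by rewrite invr_gt0.
move=> u; pose z := invmx M *m u.
have Mz : M *m z = u by rewrite mulmxA mulmxV// mul1mx.
have := posdef_dot_ge0 (u - k^-1 *: z) pM.
rewrite mulmxBr -scalemxAr Mz dotDl !dotDr !dotNl !dotNr !dotZl !dotZr.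
rewrite (_ : dot z (M *m u) = dot u u); last by rewrite dot_mulmxr pM.1 Mz.
have zu : dot z u <= k * dot u u.
  rewrite dotC (le_trans (dot_mulmx_le _ _))// ler_wpM2r ?dot_ge0//.
  by rewrite lerDl.
have : k^-1 * (k^-1 * dot z u) <= k^-1 * dot u u.
  by rewrite ler_pM2l ?invr_gt0// ler_pdivrMl.
lra.
Qed.

Lemma dot_symblock m p (D : 'M[R]_m) (O : 'M[R]_(m, p)) (S : 'M[R]_p) u v :
  dot (col_mx u v) (symblock D O S *m col_mx u v) =
  dot u (D *m u) + 2 * dot u (O *m v) + dot v (S *m v).
Proof.
rewrite /symblock mul_block_col dot_col_mx !dotDr (dot_mulmxr v) trmxK.
by rewrite (dotC (O *m v)); ring.
Qed.

End Dot.

(** * From the matrix inequality to a pointwise decrease *)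

Section RobustLMI.
Context {R : realType}.

(** The weight [s ^+ 2 / c] in Young's inequality makes the bound on [q] cancel [s] and leave
    exactly [c * dot x x]. Here [q] stands for a deviation such as [(A' - A) *m x]. *)
Lemma dot_young_bounded n m (s c : R) (w q : 'cV[R]_n) (x : 'cV[R]_m) :
  0 < s -> 0 < c -> dot q q <= s ^+ 2 * dot x x ->
  2 * dot w q <= s ^+ 2 / c * dot w w + c * dot x x.
Proof.
move=> s0 c0 qx.
apply: (le_trans (@dot_young _ _ (s ^+ 2 / c) w q _)); first by rewrite divr_gt0 ?exprn_gt0.
rewrite lerD2l invf_div -mulrA ler_pM2l// mulrC ler_pdivrMr ?exprn_gt0//.
by rewrite mulrC.
Qed.

(* The test vector puts [- y], [- C x], [x], [u] and [Q^T y] in the first five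
   blocks; in the others it nearly minimizes the form, so that the resulting
   negative terms absorb, by Young's inequality, the deviations of
   [A], [B], [C], [Q] from their nominal values. *)
Lemma LMI_robust_decrease (n r s : nat) (A : 'M[R]_n) (B : 'M[R]_(n, r))
    (C : 'M[R]_(r, n)) (Q : 'M[R]_(n, s)) (gamma sA sB sC sQ : R)
    (X P : 'M[R]_n) (U : 'M[R]_s) (alpha beta rho : R) :
  0 < sA -> 0 < sB -> 0 < sC -> 0 < sQ ->
  0 < alpha -> 0 < beta -> 0 < rho -> U^T = U ->
  posdef (Pi1 A B C Q gamma sA sB sC sQ X P U alpha beta rho) ->
  exists2 e : R, 0 < e &
    forall (A' : 'M[R]_n) (B' : 'M[R]_(n, r)) (C' : 'M[R]_(r, n))
      (Q' : 'M[R]_(n, s)),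
      specnorm (A' - A) <= sA -> specnorm (B' - B) <= sB ->
      specnorm (C' - C) <= sC -> specnorm (Q' - Q) <= sQ ->
      forall (x : 'cV[R]_n) (u : 'cV[R]_r) (y : 'cV[R]_n),
        y = A' *m x + B' *m u ->
        gamma * dot u u <= dot (C' *m x) (C' *m x) ->
        dot (Q'^T *m y) (U *m (Q'^T *m y)) + e * dot x x <= dot x (P *m x).
Proof.
move=> sA0 sB0 sC0 sQ0 al0 be0 rh0 Us /posdef_coercive[e e0 he].
exists e => // A' B' C' Q' dA dB dC dQ x u y yE.
(* Introducing these vectors through equations keeps them opaque, so that their inner products are
   atoms for [lra]. *)
have [z zE] : {z | z = C' *m x} by exists (C' *m x).
have [w wE] : {w | w = X^T *m y} by exists (X^T *m y).
have [v vE] : {v | v = Q'^T *m y} by exists (Q'^T *m y).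
have [t tE] : {t | t = U *m v} by exists (U *m v).
rewrite -zE -vE => hu.
pose V := col_mx (- y) (col_mx (- z) (col_mx x (col_mx u (col_mx v
  (col_mx ((sC / alpha) *: z) (col_mx ((sA / alpha) *: w) (col_mx (- x)
  (col_mx ((sB / beta) *: w) (col_mx (0 : 'cV[R]_r) (col_mx (- u)
  (col_mx (- (sQ / rho) *: t) (col_mx y (0 : 'cV[R]_r))))))))))))).
have xV : dot x x <= dot V V.
  rewrite !dot_col_mx; do 2!(apply: ler_wpDl; first exact: dot_ge0).
  by apply: ler_wpDr => //; do !apply: addr_ge0; exact: dot_ge0.
have {he xV} : e * dot x x <= dot V (Pi1 A B C Q gamma sA sB sC sQ X P U
    alpha beta rho *m V).
  by apply: le_trans (he V); rewrite ler_pM2l.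
rewrite /V /Pi1 !dot_symblock !mul_row_col !mul0mx.
rewrite !(dot0l, dot0r, mulmx0, add0r, addr0, mulr0).
(* The form contains [- alpha * dot x x], to be shared equally by the deviations of [A] and [C]; the
   terms in [beta] and [rho] pay for those of [B] and [Q]. With these weights the Young bounds
   cancel the negative terms exactly. *)
have al2 : 0 < alpha / 2 by rewrite divr_gt0.
have [pA pAE] : {p | p = (A' - A) *m x} by exists ((A' - A) *m x).
have [pB pBE] : {p | p = (B' - B) *m u} by exists ((B' - B) *m u).
have [pC pCE] : {p | p = (C' - C) *m x} by exists ((C' - C) *m x).
have [pQ pQE] : {p | p = (Q' - Q) *m t} by exists ((Q' - Q) *m t).
have := specnorm_dot x (ltW sA0) dA; rewrite -pAE => /(dot_young_bounded w sA0 al2).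
have := specnorm_dot u (ltW sB0) dB; rewrite -pBE => /(dot_young_bounded w sB0 be0).
have := specnorm_dot x (ltW sC0) dC; rewrite -pCE => /(dot_young_bounded z sC0 al2).
have : 2 * dot y pQ <= rho * dot y y + sQ ^+ 2 / rho * dot t t.
  rewrite (le_trans (dot_young _ _ rh0))// lerD2l mulrAC mulrC ler_pM2r ?invr_gt0//.
  by rewrite pQE specnorm_dot// ltW.
have AE : A *m x = A' *m x - pA by rewrite pAE mulmxBl opprB addrC subrK.
have BE : B *m u = B' *m u - pB by rewrite pBE mulmxBl opprB addrC subrK.
have CE : C *m x = z - pC by rewrite pCE mulmxBl opprB addrC -zE subrK.
have QE : Q *m t = Q' *m t - pQ by rewrite pQE mulmxBl opprB addrC subrK.
have Xy q : dot y (X *m q) = dot w q by rewrite dot_mulmxr wE.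
have XTy q : dot y (X^T *m q) = dot (X *m y) q by rewrite dot_mulmxr trmxK.
have Qy q : dot y (Q' *m q) = dot v q by rewrite dot_mulmxr vE.
have Uv q : dot v (U *m q) = dot t q by rewrite dot_mulmxr Us tE.
(* Through this identity the diagonal block [X + X^T] cancels the cross terms in [X *m A] and
   [X *m B], up to deviations. *)
have wy : dot w y = dot w (A' *m x) + dot w (B' *m u) by rewrite {1}yE dotDr.
rewrite !(mul_scalar_mx, mulmxDl) -!mulmxA -!scalemxAl AE BE CE -tE QE.
rewrite !(dotNl, dotNr, dotZl, dotZr, dotDr, dotDl, mulmxN, mulmxDr, Xy, XTy, Qy, Uv).
have canc (a c d : R) : 0 < c -> c * (a / c * d) = a * d.
  by move=> c0; rewrite mulrA mulrCA divff ?gt_eqF// mulr1.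
have canc2 (a d : R) : a / alpha * (2 * alpha * d) = 2 * (a * d).
  by rewrite mulrCA -mulrA canc.
have half (a : R) : a / (alpha / 2) = 2 * (a / alpha).
  by rewrite invf_div mulrCA.
have -> : dot (X *m y) y = dot w y by rewrite dotC Xy.
rewrite !half wy !mulNr !mulrN !canc2 [sB / _ * (beta * _)]mulrCA.
rewrite [rho * (_ / _ * _)]mulrCA !canc//.
(* Besides the cancelling terms there remains [gamma * dot u u - dot z z], nonpositive by [hu]. *)
lra.
Qed.

End RobustLMI.

(** * Integrals tested against functions measurable for a sub-sigma-algebra *)

Section SubSigmaAlgebra.
Context {R : realType} {d : measure_display} {Omega : measurableType d}.
Variables (P : {measure set Omega -> \bar R}) (D : set (set Omega)).
Hypothesis Dm : <<s D >> `<=` @measurable _ Omega.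

Import HBNNSimple.

Lemma measurable_fun_sub_sigma d' (T' : sigmaRingType d')
    (f : g_sigma_algebraType D -> T') :
  measurable_fun setT f -> measurable_fun [set: Omega] f.
Proof. by move=> mf _ Y mY; apply: Dm; exact: mf. Qed.

(** The level sets of [h] are events of the sub-sigma-algebra, so after this expansion only
    integrals of [f] over such events matter. *)
Lemma integral_sub_nnsfunM (h : {nnsfun (g_sigma_algebraType D) >-> R})
    (f : Omega -> R) :
  measurable_fun setT f -> (forall w, 0 <= f w) ->
  (\int[P]_w ((h w)%:E * (f w)%:E) =
   \sum_(y \in range h) y%:E * \int[P]_(w in h @^-1` [set y]) (f w)%:E)%E.
Proof.
move=> mf f0.
have mh y : measurable (h @^-1` [set y] : set Omega).
  by apply: Dm; exact: (measurable_funPTI h (measurable_set1 y)).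
have mE y : measurable_fun [set: Omega] 
    (fun w => (\1_(h @^-1` [set y]) w * f w)%:E : \bar R).
  by apply/measurable_EFinP/measurable_funM => //; exact: measurable_indic.
transitivity (\int[P]_w (\sum_(y \in range h)
    (y%:E * (\1_(h @^-1` [set y]) w * f w)%:E)))%E.
  apply: eq_integral => w _; rewrite (fimfunE h w) -fsumEFin//.
  rewrite ge0_mule_fsuml => [|y]; last exact: nnfun_muleindic_ge0.
  by apply: eq_fsbigr => y _; rewrite -!EFinM mulrA.
have ge0 y w : (0 <= y%:E * (\1_(h @^-1` [set y]) w * f w)%:E)%E.
  rewrite -EFinM mulrA EFinM; apply: mule_ge0; last by rewrite lee_fin.
  exact: nnfun_muleindic_ge0.
rewrite ge0_integral_fsum//; last first.
  by move=> y; exact: measurable_funeM.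
apply: eq_fsbigr => y /[!inE] -[w _ hw].
rewrite ge0_integralZl//; last 2 first.
- by move=> x _; rewrite lee_fin mulr_ge0.
- by rewrite lee_fin -hw.
congr (_ * _)%E; rewrite [RHS]integral_mkcond; apply: eq_integral => x _.
by rewrite epatch_indic/= muleC.
Qed.

(** This plays the part of pulling a known factor out of a conditional expectation. Simple [Z] are
    handled by level sets, general [Z] by monotone convergence. *)
Lemma eq_integral_sub_sigma (f g : Omega -> R) :
  measurable_fun setT f -> measurable_fun setT g ->
  (forall w, 0 <= f w) -> (forall w, 0 <= g w) ->
  (forall E, <<s D >> E ->
     \int[P]_(w in E) (f w)%:E = \int[P]_(w in E) (g w)%:E)%E ->
  forall Z : g_sigma_algebraType D -> \bar R,
  measurable_fun setT Z -> (forall w, 0 <= Z w)%E ->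
  (\int[P]_w (Z w * (f w)%:E) = \int[P]_w (Z w * (g w)%:E))%E.
Proof.
move=> mf mg f0 g0 fg Z mZ Z0.
pose h := nnsfun_approx measurableT mZ.
have lim_h (k : Omega -> R) : measurable_fun setT k -> (forall w, 0 <= k w) ->
    (\int[P]_w (Z w * (k w)%:E) =
     limn (fun n => \int[P]_w ((h n w)%:E * (k w)%:E)))%E.
  move=> mk k0.
  transitivity (\int[P]_w limn (fun n => (h n w)%:E * (k w)%:E))%E.
    apply: eq_integral => w _; apply/esym/cvg_lim => //.
    by apply: cvgeZr => //; exact: cvg_nnsfun_approx.
  apply: monotone_convergence => //.
  - move=> n; apply/measurable_EFinP/measurable_funM => //.
    exact/measurable_fun_sub_sigma/measurable_funP.
  - by move=> n w _; rewrite mule_ge0 ?lee_fin.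
  - move=> w _ a b ab; rewrite lee_wpmul2r ?lee_fin//.
    by have /lefP/(_ w) := nd_nnsfun_approx measurableT mZ ab.
rewrite !lim_h//; congr (limn _); apply/funext => n.
rewrite !integral_sub_nnsfunM//; apply: eq_fsbigr => y _; congr (_ * _)%E.
by apply: fg; exact: (measurable_funPTI (h n) (measurable_set1 y)).
Qed.

End SubSigmaAlgebra.

(** * Measurability of matrix-valued maps, entry by entry *)

Section MeasurableEntries.
Context {R : realType} {d : measure_display} {T : measurableType d}.
Implicit Types n m p : nat.

Definition measurable_entries n m (M : T -> 'M[R]_(n, m)) : Prop :=
  forall i j, measurable_fun setT (fun l => M l i j).

(** Coordinates are continuous, so an open interval pulls back to an open set of matrices. The
    entrywise form passes directly to sums and products. *)
Lemma mx_measurable_entries n m (M : T -> 'M[R]_(n, m)) :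
  mx_measurable M -> measurable_entries M.
Proof.
move=> mM i j; apply: (measurability _ (RGenOpens.measurableE R)).
move=> _ [_ [x [y ->] <-]]; rewrite setTI.
pose U := (fun N : 'M[R]_(n, m) => N i j) @^-1` `]x, y[%classic.
have oU : open U.
  apply: open_comp; last exact: interval_open.
  by move=> N _; exact: coord_continuous.
have := mM measurableT U; rewrite setTI; apply.
exact: sub_sigma_algebra.
Qed.

Lemma measurable_entries_cst n m (M : 'M[R]_(n, m)) :
  measurable_entries (fun=> M).
Proof. by move=> i j; exact: measurable_cst. Qed.

Lemma measurable_entriesD n m (M N : T -> 'M[R]_(n, m)) :
  measurable_entries M -> measurable_entries N ->
  measurable_entries (fun l => M l + N l).
Proof.
move=> mM mN i j; under eq_fun do rewrite mxE.
exact: measurable_funD.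
Qed.

Lemma measurable_entriesM n m p (M : T -> 'M[R]_(n, m)) (N : T -> 'M[R]_(m, p)) :
  measurable_entries M -> measurable_entries N ->
  measurable_entries (fun l => M l *m N l).
Proof.
move=> mM mN i j; under eq_fun do rewrite mxE.
by apply: measurable_sum => k; exact: measurable_funM.
Qed.

Lemma measurable_dot n (u v : T -> 'cV[R]_n) :
  measurable_entries u -> measurable_entries v ->
  measurable_fun setT (fun l => dot (u l) (v l)).
Proof.
move=> mu mv; under eq_fun do rewrite dotE.
by apply: measurable_sum => k; exact: measurable_funM.
Qed.

End MeasurableEntries.

(** * One step of the Markov chain *)

Section MarkovStep.
Context {R : realType} {d : measure_display} {T : measurableType d}.
Variables (mu : {measure set T -> \bar R}) (G : R.-pker T ~> T).
Variables (g : T -> T -> R) (nu0 : T -> R).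
Context {d' : measure_display} {Omega : measurableType d'}.
Variables (P : probability Omega R) (theta : nat -> Omega -> T).
Hypothesis hg : kernel_density mu G g.
Hypothesis hnu0 : initial_density mu nu0.
Hypothesis hmc : markov_chain mu G nu0 P theta.

Let mtheta k : measurable_fun setT (theta k).
Proof. by have [] := hmc. Qed.

Lemma kernel_fin_num l L : measurable L -> G l L \is a fin_num.
Proof.
move=> mL; rewrite ge0_fin_numE//; apply: (@le_lt_trans _ _ 1%E); last exact: ltry.
by rewrite -(prob_kernel l (s := G)); apply: le_measure; rewrite ?inE.
Qed.

Lemma chain_ae (Q : T -> Prop) k :
  {ae mu, forall l, Q l} -> {ae P, forall w, Q (theta k w)}.
Proof.
move=> [L [mL L0 QL]].
exists (theta k @^-1` L); split; last by move=> w /QL.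
  by rewrite -[X in measurable X]setTI; exact: mtheta.
have [_ h0 hS] := hmc; case: k => [|k].
  rewrite h0// null_set_integral//.
  by apply/measurable_EFinP/measurable_funTS; have [] := hnu0.
(* Taking the whole space as past event gives the law of [theta k.+1]. *)
have := hS k L setT mL; rewrite setTI => ->; last first.
  exact: (@measurableT _ (g_sigma_algebraType _)).
rewrite integral0_eq// => w _; have [mg _ ->//] := hg.
rewrite null_set_integral//; apply/measurable_EFinP/measurable_funTS.
exact: measurableT_comp mg (measurable_pair1 _).
Qed.

(* [history theta k] is convertible to [<<s past k >>]. *)
Definition past k : set (set Omega) := [set E | exists2 j, (j <= k)%N &
  exists2 U, measurable U & E = theta j @^-1` U].

Lemma past_measurable k : <<s past k >> `<=` @measurable _ Omega.
Proof.
apply: smallest_sub; first exact: sigma_algebra_measurable.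
move=> _ [j _ [U mU ->]]; rewrite -[X in measurable X]setTI.
exact: mtheta.
Qed.

Lemma measurable_state j k : (j <= k)%N ->
  measurable_fun setT (theta j : g_sigma_algebraType (past k) -> T).
Proof.
move=> jk _ U mU; rewrite setTI; apply: sub_sigma_algebra.
by exists j => //; exists U.
Qed.

(** The state at time [j] involves only the modes before [j]; hence the bound [k.+1], which makes
    the next state known from the past at time [k]. *)
Lemma measurable_entries_trajectory n (F : T -> 'M[R]_n) x0 j k :
  measurable_entries F -> (j <= k.+1)%N ->
  measurable_entries (trajectory F theta x0 j :
    g_sigma_algebraType (past k) -> 'cV[R]_n).
Proof.
move=> mF; elim: j => [|j IH] jk; first exact: measurable_entries_cst.
apply: measurable_entriesM; last by apply: IH; exact: ltnW.
by move=> i i'; apply: measurableT_comp (mF i i') (measurable_state _).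
Qed.

(** The Markov property states this for indicators of past events; it is extended here to
    past-measurable weights, such as a quadratic form in the next state. *)
Lemma markov_integral (Z : Omega -> R) (L : set T) k :
  measurable L ->
  measurable_fun setT (Z : g_sigma_algebraType (past k) -> R) ->
  (forall w, 0 <= Z w) ->
  (\int[P]_w (Z w * \1_L (theta k.+1 w))%:E =
   \int[P]_w (Z w * fine (G (theta k w) L))%:E)%E.
Proof.
move=> mL mZ Z0.
have mG : measurable_fun setT (fun l => fine (G l L)).
  exact/measurableT_comp/measurable_kernel.
under eq_integral do rewrite EFinM.
under [RHS]eq_integral do rewrite EFinM.
apply: (@eq_integral_sub_sigma _ _ _ P _ (past_measurable (k := k))
  (fun w => \1_L (theta k.+1 w)) (fun w => fine (G (theta k w) L))
  _ _ _ _ _ (fun w => (Z w)%:E)).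
- by apply: measurableT_comp (mtheta _); exact: measurable_indic.
- exact: measurableT_comp mG (mtheta _).
- by move=> w; rewrite indicE.
- by move=> w; rewrite fine_ge0.
- move=> E hE; have mE : measurable E by exact: past_measurable hE.
  have mL' : measurable (theta k.+1 @^-1` L).
    by rewrite -[X in measurable X]setTI; exact: mtheta.
  transitivity (P (E `&` theta k.+1 @^-1` L)).
    by rewrite setIC -integral_indic.
  have [_ _ ->//] := hmc.
  by apply: eq_integral => w _; rewrite fineK// kernel_fin_num.
- exact/measurable_EFinP.
- by move=> w; rewrite lee_fin.
Qed.

End MarkovStep.

(** * Geometric decay of the Lyapunov function *)

Section Lyapunov.
Context {R : realType} {d : measure_display} {T : measurableType d}.
Variables (mu : {measure set T -> \bar R}) (G : R.-pker T ~> T).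
Variable g : T -> T -> R.
Hypothesis hg : kernel_density mu G g.
Variables (n N : nat) (F : T -> 'M[R]_n) (L : 'I_N -> set T).
Variables (S : 'I_N -> 'M[R]_n) (a : R).
Hypothesis mF : measurable_entries F.
Hypothesis mL : forall i, measurable (L i).
Hypothesis coverL : forall l, exists i, L i l.
Hypothesis pS : forall i, posdef (S i).
Hypothesis a01 : 0 < a < 1.
Hypothesis decrease : {ae mu, forall l, forall i, L i l -> forall x,
  \sum_j fine (G l (L j)) * dot (F l *m x) (S j *m (F l *m x)) <=
  a * dot x (S i *m x)}.

Definition lyapunov (l : T) (x : 'cV[R]_n) : R :=
  \sum_j dot x (S j *m x) * \1_(L j) l.

Lemma lyapunov_term_ge0 j l x : 0 <= dot x (S j *m x) * \1_(L j) l.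
Proof. by rewrite mulr_ge0 ?posdef_dot_ge0// indicE. Qed.

Lemma lyapunov_ge0 l x : 0 <= lyapunov l x.
Proof. by apply: sumr_ge0 => j _; exact: lyapunov_term_ge0. Qed.

Lemma lyapunov_ge i l x : L i l -> dot x (S i *m x) <= lyapunov l x.
Proof.
move=> Li; rewrite /lyapunov (bigD1 i)//= indicE mem_set// mulr1 lerDl.
by apply: sumr_ge0 => j _; exact: lyapunov_term_ge0.
Qed.

Lemma lyapunov_coercive :
  exists2 p, 0 < p & forall l x, p * dot x x <= lyapunov l x.
Proof.
have /choice[e he] : forall i, exists e : R,
    0 < e /\ forall x, e * dot x x <= dot x (S i *m x).
  by move=> i; have [e e0 he] := posdef_coercive (pS i); exists e.
(* The inverse of this sum is a positive lower bound for all the [e i] at once. *)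
pose m := \sum_i (e i)^-1.
(* Covering a point provides an index, so the sum is not empty and [m] is positive. *)
have [i0 _] := coverL point.
have em i : (e i)^-1 <= m.
  rewrite /m (bigD1 i)//= lerDl; apply: sumr_ge0 => j _.
  by rewrite invr_ge0 ltW//; have [] := he j.
have m0 : 0 < m.
  by apply: lt_le_trans (em i0); rewrite invr_gt0; have [] := he i0.
exists m^-1; first by rewrite invr_gt0.
move=> l x; have [i Li] := coverL l; apply: le_trans (lyapunov_ge x Li).
have [e0 hei] := he i; apply: le_trans (hei x); rewrite ler_wpM2r ?dot_ge0//.
by rewrite -[leRHS]invrK lef_pV2// posrE ?invr_gt0.
Qed.

Lemma lyapunov_le l x : lyapunov l x <= (\sum_i mxsum1 (S i)) * dot x x.
Proof.
rewrite mulr_suml; apply: ler_sum => j _.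
apply: (le_trans _ (dot_mulmx_le _ _)).
by rewrite ler_piMr ?posdef_dot_ge0// indicE; case: (_ \in _).
Qed.

Section Chain.
Context {d' : measure_display} {Omega : measurableType d'}.
Variables (P : probability Omega R) (theta : nat -> Omega -> T).
Variable nu0 : T -> R.
Hypothesis hnu0 : initial_density mu nu0.
Hypothesis hmc : markov_chain mu G nu0 P theta.
Variable x0 : 'cV[R]_n.

Let X k := trajectory F theta x0 k.

Let mX j k : (j <= k.+1)%N -> measurable_entries
  (X j : g_sigma_algebraType (past theta k) -> 'cV[R]_n).
Proof. exact: measurable_entries_trajectory. Qed.

Let mform j k i : (j <= k.+1)%N -> measurable_fun setT
  ((fun w => dot (X j w) (S i *m X j w)) :
    g_sigma_algebraType (past theta k) -> R).
Proof.
move=> jk; apply: measurable_dot; first exact: mX.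
by apply: measurable_entriesM; [exact: measurable_entries_cst|exact: mX].
Qed.

Let mformP j i : measurable_fun setT (fun w => dot (X j w) (S i *m X j w)).
Proof.
exact: (measurable_fun_sub_sigma (past_measurable hmc (k := j)) (mform i (leqnSn j))).
Qed.

Let mtheta k : measurable_fun setT (theta k).
Proof. by have [] := hmc. Qed.

Let mindic k i : measurable_fun setT (fun w => \1_(L i) (theta k w) : R).
Proof. by apply: measurableT_comp (mtheta _); exact: measurable_indic. Qed.

Let mlyapunov k : measurable_fun setT (fun w => lyapunov (theta k w) (X k w)).
Proof. by apply: measurable_sum => i; exact: measurable_funM. Qed.

Lemma lyapunov_step k :
  (\int[P]_w (lyapunov (theta k.+1 w) (X k.+1 w))%:E <=
   a%:E * \int[P]_w (lyapunov (theta k w) (X k w))%:E)%E.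
Proof.
have mq i : measurable_fun setT (fun w => fine (G (theta k w) (L i))).
  have mG : measurable_fun setT (fun l => fine (G l (L i))).
    exact/measurableT_comp/measurable_kernel.
  exact: measurableT_comp mG (mtheta k).
have [a0 _] := andP a01.
rewrite -ge0_integralZl//; last 3 first.
- exact/measurable_EFinP.
- by move=> w _; rewrite lee_fin lyapunov_ge0.
- by rewrite lee_fin ltW.
(* Conditioning on the past replaces the indicator of [L j] at [theta k.+1] by its transition
   probability from [theta k]. *)
have -> : (\int[P]_w (lyapunov (theta k.+1 w) (X k.+1 w))%:E =
    \int[P]_w (\sum_j (dot (X k.+1 w) (S j *m X k.+1 w) *
      fine (G (theta k w) (L j))))%:E)%E.
  under eq_integral do rewrite /lyapunov -sumEFin.
  under [RHS]eq_integral do rewrite -sumEFin.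
  rewrite !ge0_integral_sum//; last 4 first.
  - by move=> i; apply/measurable_EFinP/measurable_funM.
  - by move=> i w _; rewrite lee_fin mulr_ge0 ?posdef_dot_ge0// fine_ge0.
  - by move=> i; apply/measurable_EFinP/measurable_funM.
  - by move=> i w _; rewrite lee_fin lyapunov_term_ge0.
  apply: eq_bigr => i _; apply: (markov_integral hmc) => //.
    exact: mform.
  by move=> w; exact: posdef_dot_ge0.
apply: ae_ge0_le_integral => //.
- move=> w _; rewrite lee_fin; apply: sumr_ge0 => i _.
  by rewrite mulr_ge0 ?posdef_dot_ge0// fine_ge0.
- apply/measurable_EFinP/measurable_sum => i.
  exact: measurable_funM.
- by move=> w _; rewrite mule_ge0// lee_fin ?lyapunov_ge0// ltW.
- by apply: measurable_funeM; exact/measurable_EFinP.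
have := chain_ae hg hnu0 hmc k decrease; apply: filterS => w hw _.
have [i Li] := coverL (theta k w).
rewrite -EFinM lee_fin.
apply: (@le_trans _ _ (a * dot (X k w) (S i *m X k w))).
  apply: le_trans (hw i Li (X k w)); apply: ler_sum => j _.
  by rewrite mulrC.
by rewrite ler_wpM2l ?(ltW a0)//; exact: lyapunov_ge.
Qed.

Lemma lyapunov_decay k :
  (\int[P]_w (lyapunov (theta k w) (X k w))%:E <=
   (a ^+ k * ((\sum_i mxsum1 (S i)) * dot x0 x0))%:E)%E.
Proof.
have [a0 _] := andP a01.
elim: k => [|k IH].
  rewrite expr0 mul1r.
  apply: (@le_trans _ _ (\int[P]_w (cst ((\sum_i mxsum1 (S i)) * dot x0 x0)%:E w))%E).
    apply: ge0_le_integral => //.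
    - by move=> w _; rewrite lee_fin lyapunov_ge0.
    - exact/measurable_EFinP/mlyapunov.
    - by move=> w _; rewrite lee_fin; exact: lyapunov_le.
  by rewrite integral_cst// [X in (_ * X)%E]probability_setT mule1.
apply: (le_trans (lyapunov_step k)).
by rewrite exprS -mulrA EFinM lee_pmul2l// lte_fin.
Qed.

Lemma second_moment_decay p k : 0 < p ->
  (forall l x, p * dot x x <= lyapunov l x) ->
  (\int[P]_w (dot (X k w) (X k w))%:E <=
   (p^-1 * (a ^+ k * ((\sum_i mxsum1 (S i)) * dot x0 x0)))%:E)%E.
Proof.
move=> p0 hp.
have mdot : measurable_fun setT (fun w => dot (X k w) (X k w)).
  apply: (measurable_fun_sub_sigma (past_measurable hmc (k := k))).
  by apply: measurable_dot; exact: mX.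
apply: (@le_trans _ _ (p^-1%:E *
    \int[P]_w (lyapunov (theta k w) (X k w))%:E)%E); last first.
  by rewrite EFinM lee_pmul2l ?lte_fin ?invr_gt0//; exact: lyapunov_decay.
rewrite -ge0_integralZl//; last 3 first.
- exact/measurable_EFinP.
- by move=> w _; rewrite lee_fin lyapunov_ge0.
- by rewrite lee_fin invr_ge0 ltW.
apply: ge0_le_integral => //.
- by move=> w _; rewrite lee_fin dot_ge0.
- exact/measurable_EFinP.
- by apply: measurable_funeM; exact/measurable_EFinP.
- by move=> w _; rewrite -EFinM lee_fin ler_pdivlMl.
Qed.

End Chain.

Lemma lyapunov_ems_stable : ems_stable mu G F.
Proof.
have [p p0 hp] := lyapunov_coercive.
have [a0 _] := andP a01.
pose c := \sum_i mxsum1 (S i).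
have c0 : 0 <= c by apply: sumr_ge0 => i _; exact: mxsum1_ge0.
(* Neither constant depends on the chain or on [x0]. The [+ 1] keeps the first one positive even if
   [c] vanishes, as for [n = 0]. *)
exists (p^-1 * (c + 1)), a; split => //.
  by rewrite mulr_gt0 ?invr_gt0// ltr_wpDl.
move=> d' Omega P nu0 theta hnu0 hmc x0 k; rewrite unlock.
under eq_integral do rewrite enorm_sqr.
apply: le_trans (second_moment_decay hnu0 hmc x0 k p0 hp) _.
rewrite lee_fin -/c enorm_sqr -!mulrA ler_pM2l ?invr_gt0//.
rewrite mulrCA ler_wpM2r ?mulr_ge0 ?dot_ge0 ?exprn_ge0 ?(ltW a0)//.
by rewrite lerDl.
Qed.

End Lyapunov.

(** * The quadratic form built from [Qmx], and the cells of the grid *)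

Lemma dot_mxcol (R : realType) (N : nat) (p : 'I_N -> nat)
    (u v : forall j, 'cV[R]_(p j)) :
  dot (\mxcol_j u j) (\mxcol_j v j) = \sum_j dot (u j) (v j).
Proof. by rewrite /dot tr_mxcol mul_mxrow_mxcol summxE. Qed.

(** Each square root occurs twice and restores the cell probability; nonnegativity matters because
    [Num.sqrt] is 0 on negative numbers. *)
Lemma dot_Qmx (R : realType) (d : measure_display) (T : measurableType d)
    (mu : {measure set T -> \bar R}) (n N : nat) (g : T -> T -> R)
    (L : 'I_N -> set T) (S : 'I_N -> 'M[R]_n) (l : T) (y : 'cV[R]_n) :
  (forall j, 0 <= cell_prob mu g L j l) ->
  dot ((Qmx mu n g L l)^T *m y) ((\mxdiag_j S j) *m ((Qmx mu n g L l)^T *m y)) =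
  \sum_j cell_prob mu g L j l * dot y (S j *m y).
Proof.
move=> q0; rewrite /Qmx tr_mxrow mxcol_mul mul_mxdiag_mxcol dot_mxcol.
apply: eq_bigr => j _; rewrite tr_scalar_mx mul_scalar_mx -scalemxAr.
by rewrite dotZl dotZr mulrA -expr2 sqr_sqrtr.
Qed.

Section Cells.
Context {R : realType} (a b : R) (ab : a < b) (N : nat) (h : nat -> R).

Lemma cell_measurable (i : 'I_N) : measurable (cell N h i : set (Theta ab)).
Proof.
pose B : set R := if i.+1 == N then `[h i, h i.+1]%classic
                  else `[h i, h i.+1[%classic.
exists B; first by rewrite /B; case: ifP => _; exact: measurable_itv.
rewrite setTI /B; apply/seteqP; split => l; rewrite /cell /=;
  by case: ifP => _ /=; rewrite in_itv.
Qed.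

Lemma cell_cover (l : Theta ab) : grid a b N h -> exists i : 'I_N, cell N h i l.
Proof.
move=> [h0 hN hS]; rewrite /cell /=.
have /andP[] : a <= @segment_val _ _ _ ab l <= b.
  by have := valP l; rewrite in_itv.
move: (segment_val l : R) => x ax xb.
(* Induction on [m] locates the half-open interval of [x]; at [m = 0] the assumption contradicts
   [a <= x]. *)
have step m : x < h m -> exists2 i, (i < m)%N & h i <= x < h i.+1.
  elim: m => [|m IH] xm; first by rewrite h0 ltNge ax in xm.
  have [hmx|/IH[i im hi]] := leP (h m) x; first by exists m; rewrite ?hmx.
  by exists i => //; exact: ltnW.
move: xb; rewrite le_eqVlt -hN => /predU1P[xN|/step[i iN /andP[hi hi1]]].
(* The right endpoint belongs to the last, closed cell, which exists because [a < b] forces [N] to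
   be positive. *)
- have N0 : (0 < N)%N by case: (N) hN => // hN; move: ab; rewrite -h0 -hN ltxx.
  have N1 : (N.-1 < N)%N by rewrite ltn_predL.
  exists (Ordinal N1); rewrite /= prednK// eqxx xN lexx andbT.
  by rewrite -[in leRHS](prednK N0) ltW// hS.
- exists (Ordinal iN); rewrite /= hi hi1; case: ifP => // _.
  exact: ltW.
Qed.

End Cells.

(** * Robust stability from the decrease on each cell *)

Theorem theorem3 (R : realType) (a b : R) (ab : a < b)
  (mu : {sigma_finite_measure set (Theta ab) -> \bar R})
  (G : R.-pker (Theta ab) ~> (Theta ab)) (g : Theta ab -> Theta ab -> R)
  (hg : kernel_density mu G g)
  (hgpos : {ae mu, forall l, (0 < \int[mu]_t (g t l)%:E)%E})
  (n r : nat)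
  (A : Theta ab -> 'M[R]_n) (B : Theta ab -> 'M[R]_(n, r))
  (C : Theta ab -> 'M[R]_(r, n))
  (hA : Hinf mu A) (hB : Hinf mu B) (hC : Hinf mu C)
  (N : nat) (h : nat -> R) (hh : grid a b N h)
  (hbar : 'I_N -> Theta ab) (hhbar : forall i, cell N h i (hbar i))
  (gamma : R) (hgamma : 0 < gamma)
  (sA sB sC sQ : 'I_N -> R)
  (hs : forall i, [/\ 0 < sA i, 0 < sB i, 0 < sC i & 0 < sQ i])
  (hsA : forall i, {ae mu, forall l, cell N h i l ->
    specnorm (A l - A (hbar i)) <= sA i})
  (hsB : forall i, {ae mu, forall l, cell N h i l ->
    specnorm (B l - B (hbar i)) <= sB i})
  (hsC : forall i, {ae mu, forall l, cell N h i l ->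
    specnorm (C l - C (hbar i)) <= sC i})
  (hsQ : forall i, {ae mu, forall l, cell N h i l ->
    specnorm (Qmx mu n g (cell N h) l - Qmx mu n g (cell N h) (hbar i)) <= sQ i})
  (hLMI : LMI_feasible (fun i => A (hbar i)) (fun i => B (hbar i))
    (fun i => C (hbar i)) (fun i => Qmx mu n g (cell N h) (hbar i))
    gamma sA sB sC sQ) :
  robustly_stable mu G A B C gamma.
Proof.
move=> Delta [mD _] /ess_supP hD.
have [X [S [al [be [rh hX]]]]] := hLMI.
have pS i : posdef (S i) by have [] := hX i.
set Q := Qmx mu n g (cell N h) in hsQ hX.
have Us : (\mxdiag_(j < N) S j)^T = \mxdiag_(j < N) S j.
  by rewrite tr_mxdiag; apply: eq_mxdiag => j; have [] := pS j.
have /choice[e he] : forall i, exists e : R, 0 < e /\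
    forall A' B' C' Q', specnorm (A' - A (hbar i)) <= sA i ->
    specnorm (B' - B (hbar i)) <= sB i -> specnorm (C' - C (hbar i)) <= sC i ->
    specnorm (Q' - Q (hbar i)) <= sQ i ->
    forall (x : 'cV[R]_n) (u : 'cV[R]_r) (y : 'cV[R]_n),
      y = A' *m x + B' *m u -> gamma * dot u u <= dot (C' *m x) (C' *m x) ->
      dot (Q'^T *m y) ((\mxdiag_(j < N) S j) *m (Q'^T *m y)) + e * dot x x <=
      dot x (S i *m x).
  move=> i; have [sA0 sB0 sC0 sQ0] := hs i; have [_ _ [al0 be0 rh0] hPi] := hX i.
  have [e e0 he] := LMI_robust_decrease sA0 sB0 sC0 sQ0 al0 be0 rh0 Us hPi.
  by exists e.
have cellE l j : fine (G l (cell N h j)) = cell_prob mu g (cell N h) j l.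
  by have [_ _ ->] := hg; last exact: cell_measurable.
(* Since [dot x (S i *m x)] is at most [mxsum1 (S i) * dot x x], hence at most [m * e i * dot x x],
   the gain [e i * dot x x] is at least the fraction [m^-1] of the form. The summand 2 puts the rate
   [1 - m^-1] strictly between 0 and 1. *)
pose m := 2 + \sum_i mxsum1 (S i) / e i.
have term_ge0 i : 0 <= mxsum1 (S i) / e i.
  by rewrite divr_ge0 ?mxsum1_ge0// ltW//; have [] := he i.
have m2 : 2 <= m by rewrite lerDl sumr_ge0.
have m0 : 0 < m by rewrite (lt_le_trans _ m2).
apply: (@lyapunov_ems_stable _ _ _ mu G g hg n N _ (cell N h) S (1 - m^-1)).
- apply: measurable_entriesD; first exact: mx_measurable_entries hA.1.
  apply: measurable_entriesM; last exact: mx_measurable_entries hC.1.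
  apply: measurable_entriesM; first exact: mx_measurable_entries hB.1.
  exact: mx_measurable_entries.
- by move=> i; exact: cell_measurable.
- by move=> l; exact: cell_cover.
- exact: pS.
- rewrite subr_gt0 invf_lt1// gtrBl invr_gt0 m0 andbT.
  by rewrite (lt_le_trans _ m2)// ltr1n.
(* There are finitely many cells, so the exceptional sets of all of them merge into one null set. *)
have hall := (filter_forall _ hsA, filter_forall _ hsB, filter_forall _ hsC,
  filter_forall _ hsQ).
move: hall => [[[allA allB] allC] allQ].
near=> l.
have Al : forall i, cell N h i l -> specnorm (A l - A (hbar i)) <= sA i by near: l.
have Bl : forall i, cell N h i l -> specnorm (B l - B (hbar i)) <= sB i by near: l.
have Cl : forall i, cell N h i l -> specnorm (C l - C (hbar i)) <= sC i by near: l.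
have Ql : forall i, cell N h i l -> specnorm (Q l - Q (hbar i)) <= sQ i by near: l.
have Dl : specnorm (Delta l) <= (Num.sqrt gamma)^-1.
  by rewrite -lee_fin; near: l.
move=> i li x; have [ei0 hei] := he i.
(* The uncertainty enters as the input [u = Delta l *m (C l *m x)]; the norm bound on [Delta] then
   yields the required constraint on [u]. *)
have := hei _ _ _ _ (Al i li) (Bl i li) (Cl i li) (Ql i li) x (Delta l *m (C l *m x)) _ erefl.
set y := A l *m x + _.
have -> : (A l + B l *m Delta l *m C l) *m x = y by rewrite mulmxDl /y !mulmxA.
have -> : gamma * dot (Delta l *m (C l *m x)) (Delta l *m (C l *m x)) <=
    dot (C l *m x) (C l *m x).
  rewrite mulrC -ler_pdivlMr// mulrC.
  have := specnorm_dot (C l *m x) _ Dl; rewrite invr_ge0 sqrtr_ge0 => /(_ isT).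
  by rewrite exprVn sqr_sqrtr// ltW.
move=> /(_ isT); rewrite dot_Qmx => [hV|j]; last by rewrite -cellE fine_ge0.
under eq_bigr do rewrite cellE.
apply: (@le_trans _ _ (dot x (S i *m x) - e i * dot x x)); first by rewrite lerBrDr.
rewrite mulrBl mul1r lerB// mulrC ler_pdivrMr//.
apply: (le_trans (dot_mulmx_le _ _)).
rewrite mulrAC ler_wpM2r ?dot_ge0// mulrC -ler_pdivrMr//.
rewrite /m (bigD1 i)//= addrCA lerDl addr_ge0// sumr_ge0//.
Unshelve. all: by end_near.
Qed.
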